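(* Let $A\in\mathrm{GH}(2n)$, and let $G\in\mathbb{R}^{2n\times2n}$ be invertible with $G^{-1}AG=J_{2n}L_0$, where $L_0=\mathrm{diag}(\beta,\beta)$, $\beta=\mathrm{diag}(\beta_1,\ldots,\beta_n)$, $\beta_1\ge\cdots\ge\beta_n>0$. Put $J=GJ_{2n}G^{\tau}$, $L=G^{-\tau}L_0G^{-1}\in\mathrm{SPD}(2n)$ and $L'=GL_0G^{\tau}\in\mathrm{SPD}(2n)$, so that $A=JL$ and $-A^{\tau}=-J^{-1}L'$. Let $k\le n$, and let $(\Psi,\Phi)$ be the test and trial basis matrices of the symplectic balancing with $\Xi=\Xi'=\beta$, $J_\Omega=-J^{-1}$ and this $G$. Then the symplectic balancing preserves pure marginal stability (i.e. $\Psi^{\tau}A\Phi\in\mathrm{GH}(2k)$) and balances the Hamiltonians of the primal and negative dual systems, i.e. $\Phi\in O(L,\mathrm{diag}(\Sigma_1,\Sigma_1))$ and $\Psi\in O(L',\mathrm{diag}(\Sigma_1,\Sigma_1))$.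
   Context: $\mathrm{GH}(m)$: real $m\times m$ matrices that are diagonalizable (over $\mathbb{C}$) with all eigenvalues nonzero and purely imaginary; a system with such a system matrix is pure marginally stable. $\mathrm{SPD}(m)$: real symmetric positive-definite $m\times m$ matrices. $J_{2n}=\begin{bmatrix}0&I_n\\-I_n&0\end{bmatrix}$. $O(M,N)$: real full-column-rank matrices $V$ with $V^{\tau}MV=N$. $\tau$ denotes transpose. Symplectic balancing: given $\Xi,\Xi'\in\mathrm{SPD}(n)$, a real nonsingular skew-symmetric $2n\times 2n$ matrix $J_\Omega$, an invertible $G\in\mathbb{R}^{2n\times2n}$ with $G^{\tau}J_\Omega G=J_{2n}$, and $k\le n$, write $\Xi=RR^{\tau}$, $\Xi'=SS^{\tau}$ with $R,S\in\mathbb{R}^{n\times n}$, take a singular value decomposition $R^{\tau}S=U\Sigma V^{\tau}$ with singular values in decreasing order, let $U_1,V_1\in\mathbb{R}^{n\times k}$ be the first $k$ columns of $U,V$ and $\Sigma_1$ the $k\times k$ diagonal matrix of the $k$ largest singular values. Put $\bar\Phi=SV_1\Sigma_1^{-1/2}$, $\bar\Psi=RU_1\Sigma_1^{-1/2}$. The trial and test basis matrices are $\Phi=G\,\mathrm{diag}(\bar\Phi,\bar\Psi)$ and $\Psi=G^{-\tau}\,\mathrm{diag}(\bar\Psi,\bar\Phi)$. *)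

(* Defs.v *)
From HB Require Import structures.
From mathcomp Require Import all_boot all_order all_algebra.
From mathcomp Require Import complex reals.

Set Implicit Arguments.
Unset Strict Implicit.
Unset Printing Implicit Defensive.

Import Order.TTheory GRing.Theory Num.Theory.

Local Open Scope ring_scope.

(* 2n x 2n matrices are typed 'M_(n + n), to match block_mx. *)

(* A in GH(m): diagonalizability and eigenvalues are taken over C = R[i]. *)
Definition GH (R : realType) (m : nat) (A : 'M[R]_m) : Prop :=
  let AC : 'M[R[i]]_m := map_mx (real_complex R) A in
  diagonalizable AC /\
  (forall z : R[i], eigenvalue AC z -> z != 0 /\ complex.Re z = 0).

Definition SPD (R : realType) (m : nat) (M : 'M[R]_m) : Prop :=
  M^T = M /\
  (forall x : 'cV[R]_m, x != 0 -> 0 < (x^T *m M *m x) 0 0).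

Definition J2 (R : realType) (n : nat) : 'M[R]_(n + n) :=
  block_mx 0 1%:M (- 1%:M) 0.

Definition bdiag (R : realType) (m n p q : nat)
    (M : 'M[R]_(m, n)) (N : 'M[R]_(p, q)) : 'M[R]_(m + p, n + q) :=
  block_mx M 0 0 N.

(* V in O(M, N) *)
Definition inO (R : realType) (m p : nat) (M : 'M[R]_m) (N : 'M[R]_p)
    (V : 'M[R]_(m, p)) : Prop :=
  \rank V = p /\ V^T *m M *m V = N.

Definition orthogonal_mx (R : realType) (n : nat) (U : 'M[R]_n) : Prop :=
  U^T *m U = 1%:M.

(* M = U diag(s) V^T, with the singular values s in decreasing order *)
Definition is_svd (R : realType) (n : nat) (M U : 'M[R]_n) (s : 'rV[R]_n)
    (V : 'M[R]_n) : Prop :=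
  [/\ orthogonal_mx U, orthogonal_mx V,
      (forall i : 'I_n, 0 <= s 0 i),
      (forall i j : 'I_n, (i <= j)%N -> s 0 j <= s 0 i)
    & M = U *m diag_mx s *m V^T].

Definition first_cols (R : realType) (m n k : nat) (hk : (k <= n)%N)
    (M : 'M[R]_(m, n)) : 'M[R]_(m, k) :=
  colsub (widen_ord hk) M.

(* diag(s)^(-1/2), for s with positive entries (0 entries are sent to 0) *)
Definition diag_invsqrt (R : realType) (k : nat) (s : 'rV[R]_k) : 'M[R]_k :=
  diag_mx (map_mx (fun x => (Num.sqrt x)^-1) s).

(* Requirements on the input of the symplectic balancing. *)
Definition symplectic_balancing_input (R : realType) (n : nat)
    (Xi Xi' : 'M[R]_n) (JOmega G : 'M[R]_(n + n)) : Prop :=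
  [/\ SPD Xi, SPD Xi',
      JOmega \in unitmx /\ JOmega^T = - JOmega,
      G \in unitmx
    & G^T *m JOmega *m G = J2 R n].

(* (Psi, Phi) are test and trial basis matrices produced by the symplectic
   balancing, and Sigma1 is the corresponding diagonal matrix of the k largest
   singular values. This is a relation, since neither the factors Xf, Xf' of
   Xi, Xi' nor the singular vectors are unique. The matrix JOmega enters only
   through the constraint on G in symplectic_balancing_input. *)
Definition symplectic_balancing (R : realType) (n k : nat) (hk : (k <= n)%N)
    (Xi Xi' : 'M[R]_n) (G : 'M[R]_(n + n))
    (Psi Phi : 'M[R]_(n + n, k + k)) (Sigma1 : 'M[R]_k) : Prop :=
  exists (Xf Xf' U V : 'M[R]_n) (s : 'rV[R]_n),
    let s1 := first_cols hk s in
    let Phibar := Xf' *m first_cols hk V *m diag_invsqrt s1 in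
    let Psibar := Xf *m first_cols hk U *m diag_invsqrt s1 in
    [/\ Xi = Xf *m Xf^T /\ Xi' = Xf' *m Xf'^T,
        is_svd (Xf^T *m Xf') U s V,
        Sigma1 = diag_mx s1,
        Phi = G *m bdiag Phibar Psibar
      & Psi = (invmx G)^T *m bdiag Psibar Phibar].

(* Main.v *)
(* In the coordinates given by G, the Hamiltonians L and L' both become
   diag(beta, beta). With beta = R R^T = S S^T and R^T S = U Sigma V^T, the Gram
   matrix of S V_1 Sigma_1^(-1/2) for beta is that of
   R^T S V_1 Sigma_1^(-1/2) = U_1 Sigma_1^(1/2), that is Sigma_1, and
   symmetrically for R U_1 Sigma_1^(-1/2). Hence both reduced Hamiltonians are
   diag(Sigma_1, Sigma_1), and the reduced system matrix is
   [0, Sigma_1; -Sigma_1, 0], with eigenvalues +- i sigma_j, where sigma_j > 0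
   because R and S are invertible. *)
Require Import Defs.
From mathcomp Require Import all_boot all_order all_algebra.
From mathcomp Require Import complex reals.

Import Order.TTheory GRing.Theory Num.Theory.

Local Open Scope ring_scope.

(** The rows of [P] are a basis of left eigenvectors of [A]. *)
Lemma diagonalizable_eq_mul {F : fieldType} {m : nat} {P A : 'M[F]_m}
    {d : 'rV[F]_m} :
  P \in unitmx -> P *m A = diag_mx d *m P -> diagonalizable A.
Proof.
move=> Pu PA; exists P => //; apply/diagonalizable_forP => // i j.
by rewrite PA mulmxK // mxE => /negbTE neq_ij; rewrite -val_eqE neq_ij.
Qed.

(** In the basis of the rows of [P], an eigenvector [v] has coordinates [w] with [w D = z w], where
    [D] is the diagonal matrix of [d]; any nonzero coordinate [w_j] forces [z = d_j]. *)
Lemma eigenvalue_eq_mul {F : fieldType} {m : nat} {P A : 'M[F]_m}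
    {d : 'rV[F]_m} {z : F} :
  P \in unitmx -> P *m A = diag_mx d *m P -> eigenvalue A z ->
  exists j, z = d 0 j.
Proof.
move=> Pu PA /eigenvalueP[v vA v0].
pose w := v *m invmx P.
have wd : w *m diag_mx d = z *: w.
  by rewrite -[diag_mx d](mulmxK Pu) -PA !mulmxA mulmxKV // vA scalemxAl.
have /rV0Pn[j wj0] : w != 0.
  by apply: contraNneq v0 => w0; rewrite -[v](mulmxKV Pu) -/w w0 mul0mx.
exists j; apply: (mulIf wj0).
by have /matrixP/(_ 0 j) := wd; rewrite mul_mx_diag !mxE mulrC => ->.
Qed.

(* [0, S; -S, 0] has the row eigenvectors (1, i) and (1, -i), with eigenvalues
   - i S and i S. *)
Lemma GH_block_diag (R : realType) (k : nat) (s : 'rV[R]_k) :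
  (forall j, s 0 j != 0) ->
  GH (block_mx 0 (diag_mx s) (- diag_mx s) 0).
Proof.
move=> s0; pose I : R[i] := 'i%C.
have II : I * I = -1 by rewrite -expr2 sqr_i.
pose sC := map_mx (real_complex R) s.
pose P : 'M[R[i]]_(k + k) := block_mx 1%:M I%:M 1%:M (- I)%:M.
(* Twice the inverse of [P], so that no fractions occur in the blocks. *)
pose Q : 'M[R[i]]_(k + k) := block_mx 1%:M 1%:M (- I)%:M I%:M.
pose d := row_mx (- I *: sC) (I *: sC).
have Pu : P \in unitmx.
  have : P *m Q = 2%:R%:M.
    rewrite mulmx_block -!scalar_mxM !mulr1 !mulrN !mulNr II !opprK -!(raddfD (@scalar_mx _ k)).
    by rewrite subrr raddf0 -scalar_mx_block.
  move=> /(congr1 (fun M => M *m (2%:R^-1)%:M)).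
  rewrite -mulmxA -scalar_mxM divff ?pnatr_eq0 // => /mulmx1_unit[] //.
rewrite /GH; set AC := map_mx (real_complex R) _.
have PA : P *m AC = diag_mx d *m P.
  rewrite /AC map_block_mx map_mxN !map_mx0 map_diag_mx -/sC diag_mx_row.
  rewrite !mulmx_block !mulmx0 !mul0mx !mul1mx !mulmx1 !addr0 !add0r.
  rewrite !mul_scalar_mx !mul_mx_scalar !linearZ /= !scalerA.
  by rewrite mulrN !mulNr II !opprK scale1r scalerN !scaleNr scalerN opprK.
split; first exact: diagonalizable_eq_mul Pu PA.
move=> z /(eigenvalue_eq_mul Pu PA)[j ->].
have Is_neq0 l : I * (s 0 l)%:C%C != 0.
  by rewrite mulf_neq0 // ?eq_complex /= ?oner_eq0 ?andbF // negb_and s0.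
have Re_Is l : complex.Re (I * (s 0 l)%:C%C) = 0 by rewrite /= mul0r mulr0 subrr.
case: (split_ordP j) => l ->; rewrite ?row_mxEl ?row_mxEr !mxE //.
by rewrite mulNr oppr_eq0 raddfN /= mul0r mulr0 subrr oppr0; split.
Qed.

Lemma SPD_congr (R : realType) (m : nat) (M P : 'M[R]_m) :
  P \in unitmx -> SPD M -> SPD (P^T *m M *m P).
Proof.
move=> Pu [Msym Mpos]; split; first by rewrite !trmx_mul trmxK Msym mulmxA.
move=> x x0; have := Mpos (P *m x); rewrite trmx_mul !mulmxA; apply.
by apply: contraNneq x0 => Px0; rewrite -[x](mulKmx Pu) Px0 mulmx0.
Qed.

Lemma SPD_diag (R : realType) (m : nat) (d : 'rV[R]_m) :
  (forall i, 0 < d 0 i) -> SPD (diag_mx d).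
Proof.
move=> d_gt0; split=> [|x x0]; first exact: tr_diag_mx.
have -> : (x^T *m diag_mx d *m x) 0 0 = \sum_i d 0 i * x i 0 ^+ 2.
  rewrite mxE; apply: eq_bigr => i _.
  by rewrite mul_mx_diag !mxE mulrAC mulrC.
have term_ge0 i : 0 <= d 0 i * x i 0 ^+ 2.
  by rewrite mulr_ge0 ?sqr_ge0 // ltW.
have /cV0Pn[i xi0] := x0.
rewrite (bigD1 i) //= ltr_wpDr ?sumr_ge0 // mulr_gt0 //.
by rewrite lt_def sqrf_eq0 xi0 sqr_ge0.
Qed.

(** Truncation becomes a right factor, so that Gram matrices of truncated factors reduce to
    associativity. *)
Lemma first_colsE (R : realType) (m n k : nat) (hk : (k <= n)%N)
    (M : 'M[R]_(m, n)) :
  first_cols hk M = M *m first_cols hk 1%:M.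
Proof. by rewrite /first_cols mulmx_colsub mulmx1. Qed.

Lemma first_cols_diag (R : realType) (n k : nat) (hk : (k <= n)%N)
    (d : 'rV[R]_n) :
  (first_cols hk 1%:M)^T *m diag_mx d *m first_cols hk 1%:M =
  diag_mx (first_cols hk d).
Proof.
rewrite -mulmxA -first_colsE; apply/matrixP=> i j; rewrite !mxE.
rewrite (bigD1 (widen_ord hk i)) //= big1 => [|l /negbTE nl].
  by rewrite !mxE eqxx mul1r addr0.
by rewrite !mxE nl mul0r.
Qed.

Lemma diag_unitmx_neq0 {F : fieldType} {n : nat} {d : 'rV[F]_n} :
  diag_mx d \in unitmx -> forall i, d 0 i != 0.
Proof.
by rewrite unitmxE det_diag unitfE => /prodf_neq0 d0 i; apply: d0.
Qed.

(** This symmetry yields the statement for [Psibar] from the one for [Phibar]. *)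
Lemma is_svd_tr {R : realType} {n : nat} {M U V : 'M[R]_n} {s : 'rV[R]_n} :
  is_svd M U s V -> is_svd M^T V s U.
Proof.
by case=> Uo Vo s0 sd ->; split=> //; rewrite !trmx_mul trmxK tr_diag_mx mulmxA.
Qed.

(** The diagonal factor of an invertible product is invertible, so the nonnegative singular values
    cannot vanish. *)
Lemma svd_unitmx_gt0 {R : realType} {n : nat} {M U V : 'M[R]_n} {s : 'rV[R]_n} :
  is_svd M U s V -> M \in unitmx -> forall i, 0 < s 0 i.
Proof.
case=> _ _ s0 _ ->; rewrite !unitmx_mul => /andP[/andP[_ su] _] i.
by rewrite lt_def s0 diag_unitmx_neq0.
Qed.

Lemma balanced_gram {R : realType} {n k : nat} (hk : (k <= n)%N)
    {X Y U V : 'M[R]_n} {s : 'rV[R]_n} :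
  is_svd (X^T *m Y) U s V -> (forall i, 0 < s 0 i) ->
  let s1 := first_cols hk s in
  let Phibar := Y *m first_cols hk V *m diag_invsqrt s1 in
  Phibar^T *m (X *m X^T) *m Phibar = diag_mx s1.
Proof.
move=> [Uo Vo _ _ svd] s_gt0 s1 Phibar.
pose E : 'M[R]_(n, k) := first_cols hk 1%:M; pose D := diag_invsqrt s1.
(* Orthogonality of [V] removes it here; that of [U] removes [U] from the Gram matrix below. *)
have XPhi : X^T *m Phibar = U *m (diag_mx s *m E) *m D.
  rewrite /Phibar first_colsE -/E !mulmxA svd.
  by rewrite -(mulmxA _ V^T V) Vo mulmx1.
have -> : Phibar^T *m (X *m X^T) *m Phibar = (X^T *m Phibar)^T *m (X^T *m Phibar).
  by rewrite [in RHS]trmx_mul trmxK !mulmxA.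
have DT : D^T = D by apply: tr_diag_mx.
rewrite XPhi !trmx_mul DT (tr_diag_mx s) !mulmxA -(mulmxA _ U^T U) Uo mulmx1.
rewrite -(mulmxA _ (diag_mx s) (diag_mx s)) mulmx_diag.
rewrite -2!(mulmxA D) first_cols_diag !mulmx_diag.
(* Each diagonal entry is [t^2 / (sqrt t)^2 = t]; as [t > 0], the inverse of [sqrt t] is a true
   inverse and not the default 0. *)
congr diag_mx; apply/rowP => j; rewrite !mxE.
set t := s _ _; have t_gt0 : 0 < t by apply: s_gt0.
have r_neq0 : Num.sqrt t != 0 by rewrite gt_eqF ?sqrtr_gt0.
have := sqr_sqrtr (ltW t_gt0); move: (Num.sqrt t) r_neq0 => r r_neq0 <-.
by rewrite !expr2 -!mulrA mulKf // mulfV // mulr1.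
Qed.

(** Full column rank comes for free: [N] has rank [p] and factors through [V]. *)
Lemma inO_of_gram (R : realType) (m p : nat) (M : 'M[R]_m) (N : 'M[R]_p)
    (V : 'M[R]_(m, p)) :
  N \in unitmx -> V^T *m M *m V = N -> inO M N V.
Proof.
move=> Nu VMV; split=> //; apply/eqP; rewrite eqn_leq rank_leq_col /=.
by rewrite -{1}(mxrank_unit Nu) -VMV mxrankM_maxr.
Qed.

Lemma tr_bdiag (R : realType) (m n p q : nat)
    (M : 'M[R]_(m, n)) (N : 'M[R]_(p, q)) : (bdiag M N)^T = bdiag M^T N^T.
Proof. by rewrite /bdiag tr_block_mx !trmx0. Qed.

Lemma mul_bdiag (R : realType) (m n l p q r : nat)
    (M : 'M[R]_(m, n)) (M' : 'M[R]_(n, l))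
    (N : 'M[R]_(p, q)) (N' : 'M[R]_(q, r)) :
  bdiag M N *m bdiag M' N' = bdiag (M *m M') (N *m N').
Proof. by rewrite /bdiag mulmx_block !mulmx0 !mul0mx !addr0 add0r. Qed.

Lemma J2_sqr (R : realType) (n : nat) : J2 R n *m J2 R n = - 1%:M.
Proof.
rewrite /J2 mulmx_block !mulNmx !mulmxN !mulmx1 !mulmx0 !addr0 !add0r.
by rewrite (scalar_mx_block n n) opp_block_mx !oppr0 addr0.
Qed.

Lemma J2_mul_bdiag (R : realType) (n k : nat) (M N : 'M[R]_(n, k)) :
  J2 R n *m bdiag M N = block_mx 0 N (- M) 0.
Proof.
rewrite /J2 /bdiag mulmx_block !mulmx0 !mul0mx !addr0 !add0r mulNmx.
by rewrite !mul1mx.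
Qed.

Lemma bdiag_mul_J2 (R : realType) (n k : nat) (M N : 'M[R]_(k, n)) :
  bdiag M N *m J2 R n = block_mx 0 M (- N) 0.
Proof.
rewrite /J2 /bdiag mulmx_block !mulmx0 !mul0mx !addr0 !add0r mulmxN.
by rewrite !mulmx1.
Qed.

Lemma tr_J2 (R : realType) (n : nat) : (J2 R n)^T = - J2 R n.
Proof.
rewrite /J2 tr_block_mx linearN /= !trmx0 trmx1 opp_block_mx.
by rewrite opprK !oppr0.
Qed.

Lemma J2_unit (R : realType) (n : nat) : J2 R n \in unitmx.
Proof.
suff /mulmx1_unit[] : J2 R n *m - J2 R n = 1%:M by [].
by rewrite mulmxN J2_sqr opprK.
Qed.

Lemma invmx_J2 (R : realType) (n : nat) : invmx (J2 R n) = - J2 R n.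
Proof.
by rewrite -[LHS]mulmx1 -[1%:M]opprK -J2_sqr mulmxN mulKmx ?J2_unit.
Qed.

Theorem corollary4p22 (R : realType) (n : nat)
    (A G : 'M[R]_(n + n)) (b : 'rV[R]_n)
    (beta : 'M[R]_n) (L0 J L L' : 'M[R]_(n + n))
    (hA : GH A)
    (hG : G \in unitmx)
    (hb_pos : forall i : 'I_n, 0 < b 0 i)
    (hb_decr : forall i j : 'I_n, (i <= j)%N -> b 0 j <= b 0 i)
    (def_beta : beta = diag_mx b)
    (def_L0 : L0 = bdiag beta beta)
    (hGA : invmx G *m A *m G = J2 R n *m L0)
    (def_J : J = G *m J2 R n *m G^T)
    (def_L : L = (invmx G)^T *m L0 *m invmx G)
    (def_L' : L' = G *m L0 *m G^T)
    (k : nat) (hk : (k <= n)%N)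
    (Psi Phi : 'M[R]_(n + n, k + k)) (Sigma1 : 'M[R]_k)
    (hbal : symplectic_balancing hk beta beta G Psi Phi Sigma1) :
  [/\ SPD L, SPD L',
      A = J *m L,
      J \in unitmx /\ - A^T = - invmx J *m L'
    & symplectic_balancing_input beta beta (- invmx J) G] /\
  [/\ GH (Psi^T *m A *m Phi),
      inO L (bdiag Sigma1 Sigma1) Phi
    & inO L' (bdiag Sigma1 Sigma1) Psi].
Proof.
have GTu : G^T \in unitmx by rewrite unitmx_tr.
have beta_SPD : SPD beta by rewrite def_beta; apply: SPD_diag.
have L0_diag : L0 = diag_mx (row_mx b b) by rewrite def_L0 def_beta diag_mx_row.
have L0_SPD : SPD L0.
  rewrite L0_diag; apply: SPD_diag => i.
  by case: (split_ordP i) => l ->; rewrite ?row_mxEl ?row_mxEr.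
have AE : A = G *m (J2 R n *m L0) *m invmx G.
  by rewrite -hGA !mulmxA mulmxV // mul1mx mulmxK.
have Ju : J \in unitmx by rewrite def_J !unitmx_mul hG GTu J2_unit.
(* The commutation holds because the two diagonal blocks of [L0] are equal. *)
have J2L0 : J2 R n *m L0 = L0 *m J2 R n.
  by rewrite def_L0 J2_mul_bdiag bdiag_mul_J2.
have NinvJ : - invmx J = (invmx G)^T *m J2 R n *m invmx G.
  suff NJ : J *m ((invmx G)^T *m J2 R n *m invmx G) = - 1%:M.
    by rewrite -[RHS](mulKmx Ju) NJ mulmxN mulmx1.
  rewrite def_J trmx_inv !mulmxA mulmxK // -(mulmxA G) J2_sqr.
  by rewrite mulmxN mulNmx mulmx1 mulmxV.
have hin : symplectic_balancing_input beta beta (- invmx J) G.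
  split=> //; rewrite NinvJ.
    split; last by rewrite !trmx_mul trmxK tr_J2 mulNmx mulmxN mulmxA.
    by rewrite !unitmx_mul unitmx_tr unitmx_inv hG J2_unit.
  by rewrite trmx_inv !mulmxA mulmxV // mul1mx mulmxKV.
split.
  split=> //.
  - by rewrite def_L; apply: SPD_congr; rewrite ?unitmx_inv.
  - by rewrite def_L' -{1}[G]trmxK; apply: SPD_congr.
  - by rewrite AE def_J def_L trmx_inv !mulmxA mulmxK.
  (* The two sides reduce to [L0 J2] and [J2 L0] between [G^-T] and [G^T], and these products agree
     by [J2L0]. *)
  split=> //; rewrite NinvJ def_L' AE !mulmxA mulmxKV // !trmx_mul tr_J2.
  by rewrite (proj1 L0_SPD) -!mulmxA !(mulmxA L0) mulmxN mulNmx mulmxN opprK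
             -J2L0 !mulmxA.
case: hbal => Xf [Xf'] [U] [V] [s] /=.
set s1 := first_cols hk s.
set Phibar := Xf' *m _ *m _; set Psibar := Xf *m _ *m _.
move=> [[bX bX'] svd def_S def_Phi def_Psi].
have beta_u : beta \in unitmx.
  rewrite def_beta unitmxE det_diag unitfE; apply/prodf_neq0 => i _.
  by rewrite gt_eqF.
(* Both square factors of the invertible [beta] are themselves invertible. *)
have M_u : Xf^T *m Xf' \in unitmx.
  move: (beta_u); rewrite unitmx_mul unitmx_tr {1}bX unitmx_mul => /andP[-> _].
  by move: beta_u; rewrite bX' unitmx_mul => /andP[].
have s_gt0 := svd_unitmx_gt0 svd M_u.
have gram_Phi : Phibar^T *m beta *m Phibar = Sigma1.
  by rewrite def_S bX; apply: (balanced_gram hk svd s_gt0).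
have gram_Psi : Psibar^T *m beta *m Psibar = Sigma1.
  have := is_svd_tr svd; rewrite trmx_mul trmxK => svd'.
  by rewrite def_S bX'; apply: (balanced_gram hk svd' s_gt0).
have s1_neq0 j : s1 0 j != 0 by rewrite mxE gt_eqF.
have S_u : bdiag Sigma1 Sigma1 \in unitmx.
  rewrite unitmxE det_ublock def_S det_diag unitfE mulf_neq0 //;
    by apply/prodf_neq0.
split.
(* The factors of [G] cancel. As [J2] swaps the blocks, the opposite orders of [Phibar] and [Psibar]
   in [Phi] and [Psi] pair each with itself, leaving the two Gram matrices off the diagonal. *)
- suff -> : Psi^T *m A *m Phi = block_mx 0 Sigma1 (- Sigma1) 0.
    by rewrite def_S; apply: GH_block_diag.
  rewrite def_Psi def_Phi AE trmx_mul trmxK tr_bdiag !mulmxA.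
  rewrite !(mulmxKV hG) -!mulmxA (mulmxA (J2 R n)) J2L0 def_L0 !mulmxA.
  rewrite mul_bdiag bdiag_mul_J2 /bdiag mulmx_block !mulmx0 !mul0mx !addr0.
  by rewrite !add0r mulNmx gram_Phi gram_Psi.
- apply: inO_of_gram => //; rewrite def_L def_Phi trmx_mul tr_bdiag.
  rewrite !mulmxA trmx_inv mulmxK // mulmxKV // def_L0.
  by rewrite !mul_bdiag gram_Phi gram_Psi.
- apply: inO_of_gram => //; rewrite def_L' def_Psi trmx_mul tr_bdiag trmxK.
  rewrite !mulmxA mulmxKV // trmx_inv mulmxK // def_L0.
  by rewrite !mul_bdiag gram_Phi gram_Psi.
Qed.
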